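(* Let $\mathcal{G}=(V,\mathcal{E})$ be a temporal graph and let $\varphi:\mathcal{E}\times 2^{\mathcal{E}}\to\mathbb{R}$ be a monotone function. Then the Decomposition Framework algorithm (the edge-peeling procedure given in the context), run on input $(\mathcal{G},\varphi)$, correctly computes $c_\varphi(e)$ for all edges $e\in\mathcal{E}$, i.e. the returned values satisfy $c[e]=c_\varphi(e)$ for every $e\in\mathcal{E}$.
   Context: A temporal graph $\mathcal{G}=(V,\mathcal{E})$ consists of a finite set $V$ of nodes and a finite set $\mathcal{E}$ of undirected temporal edges $e=(\{u,v\},t)$ with $u,v\in V$, $u\ne v$, and timestamp $t\in\mathbb{N}$. For $\mathcal{E}'\subseteq\mathcal{E}$ the edge-induced subgraph is $(V',\mathcal{E}')$ with $V'$ the set of endpoints of edges in $\mathcal{E}'$; $\mathcal{E}(\mathcal{H})$ denotes the set of temporal edges of $\mathcal{H}$. A temporal edge weight function is a map $\varphi:\mathcal{E}\times2^{\mathcal{E}}\to\mathbb{R}$. It is monotone if $\varphi(e,\mathcal{E}_1)\le\varphi(e,\mathcal{E}_2)$ for all $\mathcal{E}_1\subseteq\mathcal{E}_2\subseteq\mathcal{E}$ and all $e\in\mathcal{E}$. For $r\in\mathbb{R}$, the $(r,\varphi)$-component $\mathcal{C}^\varphi_r$ of $\mathcal{G}$ is the inclusion-maximal edge-induced subgraph of $\mathcal{G}$ such that $\varphi(e,\mathcal{E}(\mathcal{C}^\varphi_r))\ge r$ for each $e\in\mathcal{E}(\mathcal{C}^\varphi_r)$. For $e\in\mathcal{E}$,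 $c_\varphi(e)$ is the maximum $r\in\mathbb{R}$ such that $e$ is in $\mathcal{C}^\varphi_r$ but not in $\mathcal{C}^\varphi_{r'}$ for any $r'>r$. Decomposition Framework algorithm. Input: $\mathcal{G}=(V,\mathcal{E})$ and $\varphi$. (1) Initialize $c[e]=\varphi(e,\mathcal{E})$ for all $e\in\mathcal{E}$, and $\mathcal{E}'=\mathcal{E}$. (2) While $\mathcal{E}'\ne\emptyset$: choose $e\in\mathcal{E}'$ with $c[e]$ minimal among the edges in $\mathcal{E}'$ (ties broken arbitrarily); set $\mathcal{E}'\leftarrow\mathcal{E}'\setminus\{e\}$; for every affected $f\in\mathcal{E}'$ with $c[f]>c[e]$, set $c[f]\leftarrow\max(c[e],\varphi(f,\mathcal{E}'))$ (with $\mathcal{E}'$ the updated set). Here $f$ is affected if the removal of $e$ changes the value $\varphi(f,\mathcal{E}')$. (3) Return $c[e]$ for all $e\in\mathcal{E}$. *)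

(* Defs.v *)
From HB Require Import structures.
From mathcomp Require Import all_boot all_order all_algebra finmap.
From mathcomp Require Import classical_sets reals.

Set Implicit Arguments.
Unset Strict Implicit.
Unset Printing Implicit Defensive.

Import Order.TTheory GRing.Theory Num.Theory.
Local Open Scope ring_scope.

(* The edge [({u, v}, t)] is the pair of the two-element set {u, v} and t, so
   parallel edges are allowed exactly when their timestamps differ. *)
Record temporal_graph := TemporalGraph {
  node : finType;
  edges : {fset {set node} * nat};
  edges_card2 : forall e, e \in edges -> #|e.1| = 2
}.

Definition edge (G : temporal_graph) : finType := edges G.

Definition endpoints (G : temporal_graph) (e : edge G) : {set node G} :=
  (val e).1.

Definition weight (R : realType) (G : temporal_graph) : Type :=
  edge G -> {set edge G} -> R.

Definition monotone_weight (R : realType) (G : temporal_graph)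
    (phi : weight R G) : Prop :=
  forall (e : edge G) (A B : {set edge G}), A \subset B -> phi e A <= phi e B.

(* A subgraph is the pair of its node set and its edge set. *)
Definition subgraph (G : temporal_graph) : Type :=
  ({set node G} * {set edge G})%type.

Definition edge_induced (G : temporal_graph) (H : subgraph G) : Prop :=
  H.1 = (\bigcup_(e in H.2) endpoints e)%SET.

Definition subgraph_le (G : temporal_graph) (H K : subgraph G) : Prop :=
  (H.1 \subset K.1) && (H.2 \subset K.2).

Definition edge_dense (R : realType) (G : temporal_graph) (phi : weight R G)
    (r : R) (H : subgraph G) : Prop :=
  forall e : edge G, e \in H.2 -> r <= phi e H.2.

Definition is_component (R : realType) (G : temporal_graph) (phi : weight R G)
    (r : R) (C : subgraph G) : Prop :=
  [/\ edge_induced C, edge_dense phi r C &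
      forall D : subgraph G, edge_induced D -> edge_dense phi r D ->
        subgraph_le C D -> D = C].

(* A component always exists, and for a monotone weight it is unique
   ([component_exists], [component_unique] below), so that this says that [e]
   is an edge of the component at level [r]. *)
Definition in_component (R : realType) (G : temporal_graph) (phi : weight R G)
    (r : R) (e : edge G) : Prop :=
  exists2 C : subgraph G, is_component phi r C & e \in C.2.

Definition core_levels (R : realType) (G : temporal_graph) (phi : weight R G)
    (e : edge G) : set R :=
  [set r : R | in_component phi r e /\
               forall r' : R, r < r' -> ~ in_component phi r' e]%classic.

(* [r] is the maximum of [core_levels phi e]; such an [r] is unique. *)
Definition is_core_number (R : realType) (G : temporal_graph)
    (phi : weight R G) (e : edge G) (r : R) : Prop :=
  core_levels phi e r /\ ubound (core_levels phi e) r.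

(* The array c and the set of edges that remain to be processed. *)
Definition state (R : realType) (G : temporal_graph) : Type :=
  ((edge G -> R) * {set edge G})%type.

Definition init_state (R : realType) (G : temporal_graph) (phi : weight R G) :
    state R G :=
  (fun e => phi e [set: edge G]%SET, [set: edge G]%SET).

Definition affected (R : realType) (G : temporal_graph) (phi : weight R G)
    (A : {set edge G}) (e f : edge G) : bool :=
  phi f (A :\ e) != phi f A.

(* The updates for the various [f] do not interact: each one reads [c e], with
   [e] already removed, and writes [c f] only. Hence they are simultaneous. *)
Definition update (R : realType) (G : temporal_graph) (phi : weight R G)
    (c : edge G -> R) (A : {set edge G}) (e : edge G) : edge G -> R :=
  fun f => if [&& f \in A :\ e, affected phi A e f & c e < c f]
           then Num.max (c e) (phi f (A :\ e)) else c f.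

(* [e] is any edge of minimal value: ties are broken nondeterministically. *)
Inductive step (R : realType) (G : temporal_graph) (phi : weight R G) :
    state R G -> state R G -> Prop :=
| Step (c : edge G -> R) (A : {set edge G}) (e : edge G) :
    e \in A -> (forall f : edge G, f \in A -> c e <= c f) ->
    step phi (c, A) (update phi c A e, A :\ e).

(* Big-step semantics of the while loop. *)
Inductive loop (R : realType) (G : temporal_graph) (phi : weight R G) :
    state R G -> (edge G -> R) -> Prop :=
| LoopStop (c : edge G -> R) : loop phi (c, finset.set0) c
| LoopStep (s s' : state R G) (c : edge G -> R) :
    step phi s s' -> loop phi s' c -> loop phi s c.

Definition decomposition_returns (R : realType) (G : temporal_graph)
    (phi : weight R G) (c : edge G -> R) : Prop :=
  loop phi (init_state phi) c.

Lemma component_exists (R : realType) (G : temporal_graph) (phi : weight R G)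
    (r : R) : exists C : subgraph G, is_component phi r C.
Proof.
pose P (A : {set edge G}) := [forall (e | e \in A), r <= phi e A].
have P0 : P finset.set0 by apply/forall_inP => e; rewrite inE.
have [A /maxsetP[/forall_inP PA maxA] _] := maxset_exists P0.
exists ((\bigcup_(e in A) endpoints e)%SET, A); split=> //.
case=> W B /= WE PB /andP[_ /= AB].
have BA : B = A by apply: maxA => //; apply/forall_inP.
by rewrite /edge_induced /= in WE; rewrite WE BA.
Qed.

Lemma component_unique (R : realType) (G : temporal_graph) (phi : weight R G)
    (r : R) (C D : subgraph G) : monotone_weight phi ->
  is_component phi r C -> is_component phi r D -> C = D.
Proof.
move=> mon [iC dC mC] [iD dD mD].
pose U : subgraph G :=
  ((\bigcup_(e in C.2 :|: D.2) endpoints e)%SET, C.2 :|: D.2).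
have dU : edge_dense phi r U.
  move=> e; rewrite inE => /orP[eC|eD].
    exact: le_trans (dC e eC) (mon _ _ _ (finset.subsetUl _ _)).
  exact: le_trans (dD e eD) (mon _ _ _ (finset.subsetUr _ _)).
have leU (K : subgraph G) : edge_induced K -> K.2 \subset U.2 -> subgraph_le K U.
  move=> iK KU; apply/andP; split=> //; rewrite iK.
  by apply/bigcupsP => e eK; apply: finset.bigcup_sup; exact: (fintype.subsetP KU).
have UC : U = C by apply: mC => //; apply: leU => //; exact: finset.subsetUl.
have UD : U = D by apply: mD => //; apply: leU => //; exact: finset.subsetUr.
exact: etrans (esym UC) UD.
Qed.

Lemma core_number_unique (R : realType) (G : temporal_graph)
    (phi : weight R G) (e : edge G) (r s : R) :
  is_core_number phi e r -> is_core_number phi e s -> r = s.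
Proof.
by move=> [Lr ur] [Ls us]; apply/eqP; rewrite eq_le us // ur.
Qed.

(* The two lemmas below show that every execution terminates and that no
   execution gets stuck before all edges have been removed. *)
Lemma step_card (R : realType) (G : temporal_graph) (phi : weight R G)
    (s s' : state R G) : step phi s s' -> (#|s'.2| < #|s.2|)%N.
Proof. by case=> c A e eA _ /=; rewrite (cardsD1 e A) eA. Qed.

Lemma step_exists (R : realType) (G : temporal_graph) (phi : weight R G)
    (s : state R G) : s.2 != finset.set0 -> exists s' : state R G, step phi s s'.
Proof.
case: s => c A /= /set0Pn[e0 e0A].
case: (arg_minP c e0A) => e eA mine.
by exists (update phi c A e, A :\ e); apply: Step.
Qed.

(* Main.v *)
(* Call a set of edges [H] dense at level [r] if every edge of [H] has weight at
   least [r] in [H]; the edge [e] lies in the component at level [r] iff it lies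
   in some dense set at level [r].  During the peeling, [c f] never drops below
   the level of a dense set [H] that contains [f]: either [H] still survives, and
   [phi f H] is at most the current weight of [f] by monotonicity, or an edge of
   [H] has been removed, and its final value, which is at least the level of [H],
   is at most the current minimum.  Conversely, at every level up to the current
   minimum some dense set contains all the surviving edges, so the removed edge
   of minimal value attains its bound. *)
Require Import Defs.
From HB Require Import structures.
From mathcomp Require Import all_boot all_order all_algebra finmap.
From mathcomp Require Import classical_sets reals.

Set Implicit Arguments.
Unset Strict Implicit.
Unset Printing Implicit Defensive.

Import Order.TTheory.
Local Open Scope ring_scope.

Definition dense (R : realType) (G : temporal_graph) (phi : weight R G) (r : R)
    (H : {set edge G}) : Prop :=
  forall e : edge G, e \in H -> r <= phi e H.

(** By finiteness a dense set extends to an inclusion-maximal one, and the subgraph induced by that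
    set is a component. *)
Lemma in_componentP (R : realType) (G : temporal_graph) (phi : weight R G)
    (r : R) (e : edge G) :
  in_component phi r e <-> exists2 H : {set edge G}, dense phi r H & e \in H.
Proof.
split=> [[C [_ dC _] eC]|[H dH eH]]; first by exists C.2.
pose P (A : {set edge G}) := [forall (f | f \in A), r <= phi f A].
have PH : P H by apply/forall_inP.
have [A /maxsetP[/forall_inP PA maxA] HA] := maxset_exists PH.
exists ((\bigcup_(f in A) endpoints f)%SET, A); last exact: (fintype.subsetP HA).
split=> //; case=> W B /= WE PB /andP[_ /= AB].
have BA : B = A by apply: maxA => //; apply/forall_inP.
by rewrite /edge_induced /= in WE; rewrite WE BA.
Qed.

(* In [peel_exact] the second alternative covers the values [c f] that were
   raised to the value of a removed edge. *)
Record peeling_invariant (R : realType) (G : temporal_graph) (phi : weight R G)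
    (s : state R G) : Prop := PeelingInvariant {
  peel_upper : forall r H f, dense phi r H -> f \in H -> r <= s.1 f;
  peel_order : forall g f, g \notin s.2 -> f \in s.2 -> s.1 g <= s.1 f;
  peel_exact : forall f, f \in s.2 ->
    s.1 f <= phi f s.2 \/ (forall g, g \in s.2 -> s.1 f <= s.1 g);
  peel_lower : forall r, (forall f, f \in s.2 -> r <= s.1 f) ->
    exists2 H : {set edge G}, s.2 \subset H & dense phi r H;
  peel_done : forall g, g \notin s.2 ->
    exists2 H : {set edge G}, dense phi (s.1 g) H & g \in H
}.

Lemma peeling_invariant_init (R : realType) (G : temporal_graph)
    (phi : weight R G) :
  monotone_weight phi -> peeling_invariant phi (init_state phi).
Proof.
move=> mon; split=> /=.
- by move=> r H f dH fH; apply: le_trans (dH f fH) (mon _ _ _ (finset.subsetT _)).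
- by move=> g f; rewrite finset.in_setT.
- by move=> f _; left.
- by move=> r le_r; exists [set: edge G]%SET => // f; apply: le_r.
- by move=> g; rewrite finset.in_setT.
Qed.

Lemma update_notin (R : realType) (G : temporal_graph) (phi : weight R G)
    (c : edge G -> R) (A : {set edge G}) (e f : edge G) :
  f \notin A :\ e -> update phi c A e f = c f.
Proof. by rewrite /update => /negPf ->. Qed.

Lemma update_ge_min (R : realType) (G : temporal_graph) (phi : weight R G)
    (c : edge G -> R) (A : {set edge G}) (e f : edge G) :
  c e <= c f -> c e <= update phi c A e f.
Proof. by rewrite /update; case: ifP => // _ _; rewrite le_max lexx. Qed.

Lemma peeling_invariant_step (R : realType) (G : temporal_graph)
    (phi : weight R G) (s s' : state R G) :
  monotone_weight phi -> step phi s s' ->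
  peeling_invariant phi s -> peeling_invariant phi s'.
Proof.
move=> mon; case=> c A e eA mine [/= upper order exact lower done_].
have ge_e f : f \in A :\ e -> c e <= update phi c A e f.
  by move=> /finset.setD1P[_ fA]; apply/update_ge_min/mine.
have notinD1 g : g \notin A :\ e -> g = e \/ g \notin A.
  by rewrite finset.in_setD1 negb_and negbK => /orP[/eqP|]; [left|right].
have removed_le g : g \notin A :\ e -> c g <= c e.
  by move=> /notinD1[->//|gA]; apply: order.
(* An unaffected [f] keeps both its value and its weight, so the old alternative carries over; any
   other value left alone is already at most [c e]. By [ge_e], a new value of at most [c e] is
   minimal among the survivors. *)
have exact' f : f \in A :\ e ->
    update phi c A e f <= phi f (A :\ e) \/ update phi c A e f <= c e.
  move=> fA'; have /finset.setD1P[_ fA] := fA'.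
  rewrite /update fA' /=; case: ifP => [_|/negbT].
    by case: (leP (c e) (phi f (A :\ e))) => _; [left|right].
  rewrite negb_and -leNgt => /orP[|]; last by right.
  rewrite /affected negbK => /eqP ->.
  by case: (exact f fA) => [|cf_min]; [left|right; apply: cf_min].
split=> /=.
- move=> r H f dH fH; rewrite /update.
  case: ifP => _; last exact: upper dH fH.
  rewrite le_max; case: (boolP (H \subset A :\ e)) => [HA|].
    by rewrite (le_trans (dH f fH) (mon _ _ _ HA)) orbT.
  case/subsetPn=> g gH /removed_le gA.
  by rewrite (le_trans (upper _ _ _ dH gH) gA).
- move=> g f gA fA; rewrite update_notin //.
  exact: le_trans (removed_le g gA) (ge_e f fA).
- move=> f /exact'[le_phi|le_e]; [by left|right=> g gA].
  exact: le_trans le_e (ge_e g gA).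
(* Up to level [c e] the dense set around [A] still serves. Above it, the second alternative of
   [exact'] is impossible, so the survivors themselves form a dense set. *)
- move=> r le_r; case: (leP r (c e)) => [le_re|lt_er].
    have [|H AH dH] := lower r.
      by move=> f fA; apply: le_trans le_re (mine f fA).
    by exists H => //; apply: fintype.subset_trans (finset.subD1set A e) AH.
  exists (A :\ e) => // f fA; have le_rf := le_r f fA.
  case: (exact' f fA) => [|le_e]; first exact: le_trans le_rf.
  by have := lt_le_trans lt_er (le_trans le_rf le_e); rewrite ltxx.
- move=> g gA; rewrite update_notin //; case: (notinD1 g gA) => [->|]; last exact: done_.
  (* Minimality of [c e] makes it an admissible level for the state before the removal, where [A]
     still contains [e]. *)
  have [H AH dH] := lower (c e) mine.
  by exists H => //; apply: (fintype.subsetP AH).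
Qed.

Lemma peeling_invariant_loop (R : realType) (G : temporal_graph)
    (phi : weight R G) (s : state R G) (c : edge G -> R) :
  monotone_weight phi -> loop phi s c -> peeling_invariant phi s ->
  peeling_invariant phi (c, finset.set0).
Proof.
move=> mon; elim=> // {}s s' {}c st _ IH inv.
exact: IH (peeling_invariant_step mon st inv).
Qed.

Lemma loop_terminates (R : realType) (G : temporal_graph) (phi : weight R G)
    (s : state R G) : exists c : edge G -> R, loop phi s c.
Proof.
have [n] := ubnP #|s.2|; elim: n s => // n IH s lt_s.
have [A0|/(step_exists phi)[s' st]] := eqVneq s.2 finset.set0.
  by case: s A0 {lt_s} => c A /= ->; exists c; apply: LoopStop.
have [c lc] := IH s' (leq_trans (step_card st) lt_s).
by exists c; apply: LoopStep st lc.
Qed.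

Theorem theorem1 (R : realType) (G : temporal_graph) (phi : weight R G)
    (phi_monotone : monotone_weight phi) :
  (exists c : edge G -> R, decomposition_returns phi c) /\
  (forall c : edge G -> R, decomposition_returns phi c ->
     forall e : edge G, is_core_number phi e (c e)).
Proof.
split=> [|c ret e]; first exact: loop_terminates.
have inv := peeling_invariant_loop phi_monotone ret
  (peeling_invariant_init phi_monotone).
have upper r : in_component phi r e -> r <= c e.
  by case/in_componentP => H; apply: (peel_upper inv).
split; last by move=> r [/upper].
(* At the end no edge survives, so [peel_done] applies to every edge. *)
split; first by apply/in_componentP/(peel_done inv); rewrite finset.in_set0.
by move=> r' lt_r' /upper; rewrite leNgt lt_r'.
Qed.
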